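(* Let $0<s<1\leq w$, let $X\subseteq \mathbb{R}\times[s,w-s]$ be $s$-separated and let $Y\subseteq X$. Then there exists a $\frac{1200w}{s}$-bilipschitz mapping $\gamma=(\gamma_{1},\gamma_{2})\colon \mathbb{R}\to\mathbb{R}^{2}$ such that the following statements hold: (i) $|\gamma_{1}(t)-t|\leq \frac{s}{4}$ and $0\leq \gamma_{2}(t)\leq w$ for all $t\in\mathbb{R}$. (ii) $\operatorname{dist}(x,\gamma(t))\geq \frac{2s}{100}$ for all $t\in\mathbb{R}$ and $x\in X$. (iii) Letting $W_{+}$ and $W_{-}$ denote the connected components of $\mathbb{R}^{2}\setminus \gamma(\mathbb{R})$ containing $\mathbb{R}\times (w,\infty)$ and $\mathbb{R}\times (-\infty,0)$ respectively, we have $Y\subseteq W_{-}$ and $X\setminus Y\subseteq W_{+}$.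
   Context: $\mathbb{R}^2$ carries the Euclidean norm $\|\cdot\|$, and $\operatorname{dist}$ is the Euclidean distance. A set $X\subseteq\mathbb{R}^2$ is $s$-separated if $\|a-a'\|\geq s$ for all distinct $a,a'\in X$. For $M\geq 1$, a mapping $\gamma\colon\mathbb{R}\to\mathbb{R}^2$ is $M$-bilipschitz if $\frac{1}{M}|t-t'|\leq\|\gamma(t)-\gamma(t')\|\leq M|t-t'|$ for all $t,t'\in\mathbb{R}$. *)

(* Defs.v *)
From HB Require Import structures.
From mathcomp Require Import all_boot all_order all_algebra.
From mathcomp Require Import all_classical all_reals all_analysis.

Set Implicit Arguments.
Unset Strict Implicit.
Unset Printing Implicit Defensive.

Import Order.TTheory GRing.Theory Num.Theory.
Import numFieldNormedType.Exports.

Local Open Scope classical_set_scope.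
Local Open Scope ring_scope.

(* The library's norm on the product [R * R] is the max norm, so the Euclidean
   norm is defined here. The topology is the library's product topology, which
   is the Euclidean one. *)
Definition eucl_norm (R : realType) (p : R * R) : R :=
  Num.sqrt (p.1 ^+ 2 + p.2 ^+ 2).

Definition eucl_dist (R : realType) (p q : R * R) : R := eucl_norm (p - q).

Definition separated_by (R : realType) (s : R) (X : set (R * R)) : Prop :=
  forall a a' : R * R, X a -> X a' -> a <> a' -> s <= eucl_dist a a'.

Definition bilipschitz (R : realType) (M : R) (gamma : R -> R * R) : Prop :=
  forall t t' : R,
    M^-1 * `|t - t'| <= eucl_dist (gamma t) (gamma t') /\
    eucl_dist (gamma t) (gamma t') <= M * `|t - t'|.

Definition is_component (T : topologicalType) (A W : set T) : Prop :=
  exists2 x, A x & W = connected_component A x.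

(* Main.v *)
Require Import Defs.
From HB Require Import structures.
From mathcomp Require Import all_boot all_order all_algebra.
From mathcomp Require Import all_classical all_reals all_analysis.
From mathcomp Require Import ring lra zify.

Set Implicit Arguments.
Unset Strict Implicit.
Unset Printing Implicit Defensive.

Import Order.TTheory GRing.Theory Num.Theory.
Import numFieldNormedType.Exports.
Local Open Scope classical_set_scope.
Local Open Scope ring_scope.

(** The curve is the image of a graph under a horizontal shear.

    Cut the line at the multiples of [s / 8].  Each point [p] of [X] lies within
    horizontal distance [s / 8] of a point [q p] of the same height whose
    abscissa is an even multiple of [s / 8] if [p] is in [Y], and an odd one
    otherwise ([grid_approx]).  A single wave [f], with values in [0, w] and
    Lipschitz constant [16 * w / s], equals [w] near the even multiples and [0]
    near the odd ones ([wave_exists]), so its graph passes above every [q p] with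
    [p] in [Y], below every other [q p], and stays [3 * s / 100] away from all of
    them ([wave_far]).

    The points [q p] are still [3 * s / 4]-separated, and the displacements
    needed to bring them back to [p] differ by at most [s / 4]; hence these
    displacements extend to a [1 / 3]-Lipschitz function [h] on the plane, by
    McShane's formula ([mcshane]).  The shear [(x, y) |-> (x + h (x, y), y)] is
    then bilipschitz with constants [2 / 3] and [4 / 3] ([shear_dist_ge],
    [shear_dist_le]) and sends [q p] to [p], so a distance of [3 * s / 100] becomes one of
    at least [2 * s / 100].  The curve is the image of the graph of [f]; a
    vertical ray from [q p] that avoids the graph is sent to a path that avoids
    the curve and joins [p] to the half-plane above or below the strip. *)

(** * Lipschitz extension *)

(** McShane's extension theorem with prescribed bounds: prescribed values [v i]
    at points [c i], for [i] in [A], that are [L]-Lipschitz for the pseudometric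
    [D] extend to an [L]-Lipschitz function with the same bounds. *)
Lemma mcshane (R : realType) (T I : Type) (D : T -> T -> R) (L lo hi : R)
    (A : set I) (c : I -> T) (v : I -> R) :
  0 <= L -> lo <= hi ->
  (forall x, D x x = 0) -> (forall x y, 0 <= D x y) ->
  (forall x y, D x y = D y x) ->
  (forall x y z, D x z <= D x y + D y z) ->
  (forall i, A i -> lo <= v i <= hi) ->
  (forall i j, A i -> A j -> v i <= v j + L * D (c i) (c j)) ->
  exists F : T -> R,
    [/\ forall i, A i -> F (c i) = v i,
        forall x y, `|F x - F y| <= L * D x y
      & forall x, lo <= F x <= hi].
Proof.
move=> L0 lohi D0 Dge0 Dsym Dtri vb vL.
(* [hi] belongs to the family whose infimum is taken, which keeps it nonempty
   and bounds the extension from above. *)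
pose S x := [set hi] `|` [set v i + L * D (c i) x | i in A].
have Slo x : lbound (S x) lo.
  move=> _ [->//|[i Ai <-]]; have /andP[vi _] := vb i Ai.
  by rewrite (le_trans vi)// lerDl mulr_ge0.
have Shas x : has_lbound (S x) by exists lo.
have S0 x : S x !=set0 by exists hi; left.
have half x y : inf (S x) <= inf (S y) + L * D x y.
  rewrite -lerBlDr; apply: lb_le_inf => // _ [->|[i Ai <-]]; rewrite lerBlDr.
    apply: (@le_trans _ _ hi); last by rewrite lerDl mulr_ge0.
    by apply: ge_inf => //; left.
  apply: (@le_trans _ _ (v i + L * D (c i) x)).
    by apply: ge_inf => //; right; exists i.
  rewrite -addrA lerD2l -mulrDr ler_wpM2l// (Dsym x).
  exact: Dtri.
exists (fun x => inf (S x)); split.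
- move=> i Ai; apply/eqP; rewrite eq_le; apply/andP; split.
    apply: ge_inf => //; right; exists i => //.
    by rewrite D0 mulr0 addr0.
  apply: lb_le_inf => // _ [->|[j Aj <-]]; first by case/andP: (vb i Ai).
  by rewrite Dsym vL.
- move=> x y; rewrite ler_norml; apply/andP; split.
    by rewrite lerBrDr addrC -lerBrDr opprK Dsym half.
  by rewrite lerBlDr addrC half.
- move=> x; apply/andP; split; first exact: lb_le_inf.
  by apply: ge_inf => //; left.
Qed.

Lemma lipschitz_continuous_real (R : realType) (L : R) (f : R -> R) :
  (forall x y, `|f x - f y| <= L * `|x - y|) -> continuous f.
Proof.
move=> fL x; apply/cvgrPdist_lt => e e0.
have L1 : 0 < `|L| + 1 by rewrite ltr_wpDl.
near=> y; apply: (le_lt_trans (fL x y)).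
apply: (@le_lt_trans _ _ ((`|L| + 1) * `|x - y|)).
  by rewrite ler_wpM2r// (le_trans (ler_norm L))// lerDl.
rewrite -ltr_pdivlMl// mulrC.
near: y; apply: cvgr_dist_lt; first exact: cvg_id.
by rewrite divr_gt0.
Unshelve. all: by end_near.
Qed.

(** * The Euclidean plane *)

Section EuclideanDistance.
Variable R : realType.
Implicit Types (p q u v : R * R) (a b c d : R).

Lemma eucl_distE p q :
  eucl_dist p q = Num.sqrt ((p.1 - q.1) ^+ 2 + (p.2 - q.2) ^+ 2).
Proof. by []. Qed.

Lemma minkowski2 a b c d :
  Num.sqrt ((a + c) ^+ 2 + (b + d) ^+ 2) <=
  Num.sqrt (a ^+ 2 + b ^+ 2) + Num.sqrt (c ^+ 2 + d ^+ 2).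
Proof.
have E0 : 0 <= a ^+ 2 + b ^+ 2 by rewrite addr_ge0 ?sqr_ge0.
have F0 : 0 <= c ^+ 2 + d ^+ 2 by rewrite addr_ge0 ?sqr_ge0.
set P := Num.sqrt (a ^+ 2 + _); set Q := Num.sqrt (c ^+ 2 + _).
have P0 : 0 <= P by exact: sqrtr_ge0.
have Q0 : 0 <= Q by exact: sqrtr_ge0.
have cauchy : a * c + b * d <= P * Q.
  rewrite -sqrtrM// (le_trans (ler_norm _))// -sqrtr_sqr ler_sqrt; last first.
    by rewrite mulr_ge0.
  by have := sqr_ge0 (a * d - b * c); nra.
have -> : P + Q = Num.sqrt ((P + Q) ^+ 2).
  by rewrite sqrtr_sqr ger0_norm// addr_ge0.
rewrite ler_sqrt ?sqr_ge0// [leRHS]sqrrD !sqr_sqrtr//.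
by move: cauchy; nra.
Qed.

Lemma eucl_dist_ge0 p q : 0 <= eucl_dist p q.
Proof. exact: sqrtr_ge0. Qed.

Lemma eucl_distxx p : eucl_dist p p = 0.
Proof. by rewrite eucl_distE !subrr expr0n addr0 sqrtr0. Qed.

Lemma eucl_distC p q : eucl_dist p q = eucl_dist q p.
Proof.
by rewrite !eucl_distE -(sqrrN (p.1 - q.1)) -(sqrrN (p.2 - q.2)) !opprB.
Qed.

Lemma eucl_dist_triangle p q r :
  eucl_dist p r <= eucl_dist p q + eucl_dist q r.
Proof.
have := minkowski2 (p.1 - q.1) (p.2 - q.2) (q.1 - r.1) (q.2 - r.2).
by rewrite !eucl_distE !addrA !subrK.
Qed.

Lemma ler_norm1_eucl p q : `|p.1 - q.1| <= eucl_dist p q.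
Proof.
by rewrite eucl_distE -sqrtr_sqr ler_sqrt ?addr_ge0 ?sqr_ge0// lerDl sqr_ge0.
Qed.

Lemma ler_norm2_eucl p q : `|p.2 - q.2| <= eucl_dist p q.
Proof.
by rewrite eucl_distE -sqrtr_sqr ler_sqrt ?addr_ge0 ?sqr_ge0// lerDr sqr_ge0.
Qed.

Lemma eucl_dist_horizontal a b c : eucl_dist (a, c) (b, c) = `|a - b|.
Proof. by rewrite eucl_distE/= subrr expr0n addr0 sqrtr_sqr. Qed.

Lemma eucl_dist_vertical a b c : eucl_dist (a, b) (a, c) = `|b - c|.
Proof. by rewrite eucl_distE/= subrr expr0n add0r sqrtr_sqr. Qed.

Lemma eucl_dist_le_l1 p q : eucl_dist p q <= `|p.1 - q.1| + `|p.2 - q.2|.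
Proof.
have := eucl_dist_triangle p (q.1, p.2) q.
case: p q => [p1 p2] [q1 q2] /=.
by rewrite eucl_dist_horizontal eucl_dist_vertical.
Qed.

End EuclideanDistance.

(** * Horizontal shears *)

Section Shear.
Variable R : realType.
Implicit Types u v : R * R.

(** The horizontal displacement of the plane by the function [h]. *)
Definition shear (h : R * R -> R) u : R * R := (u.1 + h u, u.2).

Variable h : R * R -> R.
Hypothesis h_lip : forall u v, `|h u - h v| <= 1 / 3 * eucl_dist u v.

Lemma shear_dist_sandwich u v :
  `|eucl_dist (shear h u) (shear h v) - eucl_dist u v| <= `|h u - h v|.
Proof.
(* Up to a common translation, the two pairs differ only in the abscissa of the
   second point, by [h u - h v]. *)
pose z : R * R := (v.1 - (h u - h v), v.2).
have -> : eucl_dist (shear h u) (shear h v) = eucl_dist u z.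
  rewrite !eucl_distE/=; congr (Num.sqrt (_ ^+ 2 + _)); ring.
have zv : eucl_dist z v = `|h u - h v|.
  rewrite /z; case: (v) (h u - h v) => v1 v2 k /=.
  by rewrite eucl_dist_horizontal addrAC subrr add0r normrN.
have := eucl_dist_triangle u z v; have := eucl_dist_triangle u v z.
by rewrite (eucl_distC v z) zv ler_norml; lra.
Qed.

Lemma shear_dist_le u v :
  eucl_dist (shear h u) (shear h v) <= 4 / 3 * eucl_dist u v.
Proof.
move: (shear_dist_sandwich u v) (h_lip u v).
by rewrite ler_norml => /andP[]; lra.
Qed.

Lemma shear_dist_ge u v :
  2 / 3 * eucl_dist u v <= eucl_dist (shear h u) (shear h v).
Proof.
move: (shear_dist_sandwich u v) (h_lip u v).
by rewrite ler_norml => /andP[]; lra.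
Qed.

Lemma shear_inj : injective (shear h).
Proof.
move=> u v huv; have := shear_dist_ge u v.
rewrite huv eucl_distxx => uv0.
have d0 : eucl_dist u v <= 0 by lra.
have /normr0_eq0/eqP : `|u.1 - v.1| = 0.
  by apply/le_anti; rewrite normr_ge0 (le_trans (ler_norm1_eucl u v)).
have /normr0_eq0/eqP : `|u.2 - v.2| = 0.
  by apply/le_anti; rewrite normr_ge0 (le_trans (ler_norm2_eucl u v)).
rewrite !subr_eq0.
by case: u v {huv uv0 d0} => [u1 u2] [v1 v2] /= /eqP -> /eqP ->.
Qed.

Lemma shear_vertical_continuous (x : R) : continuous (fun y => shear h (x, y)).
Proof.
move=> y; apply: (@cvg_pair _ _ _ _ (nbhs (x + h (x, y))) (nbhs y)
  _ _ _ (fun z => x + h (x, z)) id) => /=; last exact: cvg_id.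
apply: cvgD; first exact: cvg_cst.
apply: (@lipschitz_continuous_real _ (1 / 3) (fun z => h (x, z))) => a b.
by rewrite -(eucl_dist_vertical x a b) h_lip.
Qed.

End Shear.

(** * Paths and components *)

Lemma path_connected_component (R : realType) (T : topologicalType)
    (A : set T) (c : R -> T) (E : set R) (a b : R) :
  continuous c -> is_interval E -> E a -> E b ->
  (forall t, E t -> A (c t)) -> connected_component A (c a) (c b).
Proof.
move=> cc /connected_intervalP Ec Ea Eb EA.
apply: (@connected_component_max _ A (c @` E)); [by exists a| | |by exists b].
  by move=> _ [t Et <-]; exact: EA.
by apply: connected_continuous_connected => //; exact: continuous_subspaceT.
Qed.

Lemma segment_connected_component (R : realType) (A : set (R * R))
    (x y : R * R) :
  (forall t, 0 <= t <= 1 ->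
    A (x.1 + t * (y.1 - x.1), x.2 + t * (y.2 - x.2))) ->
  connected_component A x y.
Proof.
move=> HA.
pose c (t : R) : R * R := (x.1 + t * (y.1 - x.1), x.2 + t * (y.2 - x.2)).
have -> : x = c 0 by rewrite /c !mul0r !addr0; case: (x).
have -> : y = c 1.
  by rewrite /c !mul1r addrCA subrr addr0 addrCA subrr addr0; case: (y).
apply: (@path_connected_component _ _ _ _ [set` `[0, 1]]).
- have affine_cvg (d e t : R) : d + z * e @[z --> t] --> d + t * e.
    apply: cvgD; first exact: cvg_cst.
    by apply: cvgM; [exact: cvg_id|exact: cvg_cst].
  move=> t; apply: (@cvg_pair _ _ _ _
    (nbhs (x.1 + t * (y.1 - x.1))) (nbhs (x.2 + t * (y.2 - x.2))) _ _ _
    (fun z => x.1 + z * (y.1 - x.1)) (fun z => x.2 + z * (y.2 - x.2)));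
    exact: affine_cvg.
- exact: interval_is_interval.
- by rewrite /= in_itv /= lexx ler01.
- by rewrite /= in_itv /= lexx ler01.
- by move=> t; rewrite /= in_itv /= => /HA.
Qed.

(** * The grid and the wave *)

(** The [m]-th multiple of [g] of parity [b], where [true] means odd. *)
Definition grid (R : realType) (g : R) (b : bool) (m : int) : R :=
  g * (m%:~R * 2 + b%:R).

Lemma grid_approx (R : realType) (g : R) (b : bool) (x : R) : 0 < g ->
  exists m : int, `|x - grid g b m| <= g.
Proof.
move=> g0; pose y := (x / g - b%:R + 1) / 2.
exists (Num.floor y); rewrite /grid.
have /andP[] := floor_itv y; rewrite intrD.
move: (Num.floor y)%:~R => k ky yk.
have xE : x = g * (2 * y - 1 + b%:R).
  by rewrite /y; field; rewrite gt_eqF.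
rewrite [in X in X - _]xE -mulrBr normrM gtr0_norm// ger_pMr// ler_norml.
by apply/andP; split; lra.
Qed.

Lemma grid_sep (R : realType) (g : R) (m n : int) : 0 < g ->
  g <= `|grid g false m - grid g true n|.
Proof.
move=> g0; rewrite /grid -mulrBr normrM gtr0_norm// ler_pMr//.
have -> : m%:~R * 2 + false%:R - (n%:~R * 2 + true%:R) =
    (m * 2 - (n * 2 + 1))%:~R :> R.
  by rewrite intrB intrD !intrM addr0.
rewrite -intr_norm (ler_int R 1).
lia.
Qed.

(** A wave equal to [w] on the [d]-neighbourhood of the even multiples of [g] and
    to [0] on that of the odd ones. *)
Lemma wave_exists (R : realType) (g d w K : R) :
  0 < g -> 0 <= w -> 0 <= K -> w <= K * (g - 2 * d) ->
  exists f : R -> R,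
    [/\ forall t, 0 <= f t <= w,
        forall t u, `|f t - f u| <= K * `|t - u|
      & forall b m t, `|t - grid g b m| <= d -> f t = if b then 0 else w].
Proof.
move=> g0 w0 K0 wK.
(* Indexing by the parity together with the point makes the prescribed value a
   function of the index, with no disjointness argument. *)
pose A := [set i : bool * R | exists m, `|i.2 - grid g i.1 m| <= d].
pose v (i : bool * R) : R := if i.1 then 0 else w.
have far b b' m m' t u : b != b' -> `|t - grid g b m| <= d ->
    `|u - grid g b' m'| <= d -> w <= K * `|t - u|.
  move=> bb' tm um; apply: (le_trans wK); rewrite ler_wpM2l//.
  have gg : g <= `|grid g b m - grid g b' m'|.
    by case: b b' bb' {tm um} => -[]//= _; rewrite ?grid_sep// distrC grid_sep.
  have := ler_distD t (grid g b m) (grid g b' m').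
  have := ler_distD u t (grid g b' m').
  rewrite (distrC (grid g b m) t); lra.
have [||||i Ai|i j Ai Aj|f [fv fL fb]] := @mcshane R R (bool * R)
  (fun x y => `|x - y|) K 0 w A snd v K0 w0.
- by move=> x; rewrite subrr normr0.
- by [].
- by move=> x y; rewrite distrC.
- by move=> x y z; rewrite ler_distD.
- by rewrite /v; case: ifP; rewrite ?lexx ?w0.
- have KD : 0 <= K * `|i.2 - j.2| by rewrite mulr_ge0.
  case: i j Ai Aj KD => [b t] [b' u] [m tm] [m' um] /= KD.
  have [<-|bb'] := eqVneq b b'; first by rewrite /v /= lerDl.
  have := far _ _ _ _ _ _ bb' tm um.
  by rewrite /v; case: b b' {bb' tm um} => -[] /=; lra.
- exists f; split=> // b m t tm.
  by rewrite (fv (b, t))//; exists m.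
Qed.

(** Once moved onto the grid, a point at distance at least [s] from the heights
    [0] and [w] is far from the graph of the wave: horizontally, or vertically
    where the wave is flat. *)
Lemma wave_far (R : realType) (g d w s : R) (f : R -> R) (b : bool) (m : int)
    (y t : R) :
  d <= s -> s <= y <= w - s ->
  (forall b m t, `|t - grid g b m| <= d -> f t = if b then 0 else w) ->
  d <= eucl_dist (grid g b m, y) (t, f t).
Proof.
move=> ds /andP[sy yw] fE; have [tm|/ltW tm] := leP `|t - grid g b m| d.
  apply: (le_trans ds); apply: le_trans (ler_norm2_eucl _ _).
  rewrite /= (fE _ _ _ tm) ler_normr; case: b {tm} => /=; apply/orP; lra.
apply: (le_trans tm); rewrite distrC.
exact: (ler_norm1_eucl (grid g b m, y) (t, f t)).
Qed.

Unset Implicit Arguments.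

Theorem theorem4p1 (R : realType) (s w : R) (X Y : set (R * R))
  (s_gt0 : 0 < s) (s_lt1 : s < 1) (w_ge1 : 1 <= w)
  (X_strip : X `<=` [set: R] `*` [set` `[s, w - s]])
  (X_sep : separated_by s X)
  (YX : Y `<=` X) :
  exists gamma : R -> R * R,
    [/\ bilipschitz (1200 * w / s) gamma,
        (forall t : R,
           `|(gamma t).1 - t| <= s / 4 /\ 0 <= (gamma t).2 <= w),
        (forall (t : R) (x : R * R), X x ->
           2 * s / 100 <= eucl_dist x (gamma t))
      & exists Wp Wm : set (R * R),
        [/\ is_component (~` range gamma) Wp
              /\ [set: R] `*` [set` `]w, +oo[ ] `<=` Wp,
            is_component (~` range gamma) Wm
              /\ [set: R] `*` [set` `]-oo, 0[ ] `<=` Wm,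
            Y `<=` Wm
          & X `\` Y `<=` Wp]].

Proof.
have w0 : 0 < w by lra.
have g0 : 0 < s / 8 by lra.
have ws1 : 1 <= w / s by rewrite ler_pdivlMr//; lra.
pose K := 16 * w / s.
have KE : K = 16 * (w / s) by rewrite /K mulrA.
(* The slope suffices because the wave has room [s / 8 - 2 * (3 * s / 100)],
   that is [13 * s / 200], to climb from [0] to [w], and [16 * (13 / 200)] is
   [26 / 25]. *)
have [|||f [f0w fK fE]] := @wave_exists R (s / 8) (3 * s / 100) w K g0.
- exact: ltW.
- by rewrite KE; lra.
- rewrite /K (_ : _ * _ = w * (26 / 25)); first by lra.
  by field; rewrite gt_eqF.
(* [true], the odd parity, is for the points that must lie above the curve. *)
pose b (p : R * R) := p \notin Y.
have /choice[m mP] (p : R * R) : exists m, `|p.1 - grid (s / 8) (b p) m| <= s / 8.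
  exact: grid_approx.
pose q (p : R * R) : R * R := (grid (s / 8) (b p) (m p), p.2).
pose v (p : R * R) : R := p.1 - (q p).1.
have vE p : v p <= s / 8 /\ - (s / 8) <= v p.
  by have := mP p; rewrite ler_norml => /andP[].
have [|||||||p p' Xp Xp'|h [hv hL hb]] := @mcshane R (R * R) (R * R)
  (@eucl_dist R) (1 / 3) (- (s / 8)) (s / 8) X q v.
- by lra.
- by lra.
- exact: eucl_distxx.
- exact: eucl_dist_ge0.
- exact: eucl_distC.
- exact: eucl_dist_triangle.
- by move=> p _; have [] := vE p; move=> ? ?; apply/andP.
- have [<-|pp'] := pselect (p = p').
    by rewrite eucl_distxx mulr0 addr0.
  have pq r : eucl_dist r (q r) <= s / 8.
    by case: r => r1 r2; rewrite /q eucl_dist_horizontal; exact: (mP (r1, r2)).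
  have := X_sep p p' Xp Xp' pp'; have := eucl_dist_triangle p (q p) p'.
  have := eucl_dist_triangle (q p) (q p') p'.
  have := pq p; have := pq p'; rewrite (eucl_distC p' (q p')).
  by have [? ?] := vE p; have [? ?] := vE p'; lra.
have hq p : X p -> shear h (q p) = p.
  by move=> Xp; rewrite /shear hv// /v addrC subrK; case: (p).
pose gamma t := shear h (t, f t).
have gamma2 t : 0 <= (gamma t).2 <= w by exact: f0w.
have Xs p : X p -> s <= p.2 <= w - s.
  by move=> /X_strip[_] /=; rewrite in_itv.
have fq p : f (q p).1 = if b p then 0 else w.
  by apply: (fE _ (m p)); rewrite subrr normr0; lra.
(* A vertical line meets the graph of [f] once, so the image of the part of it
   on one side of the graph avoids the curve. *)
have off x y : y != f x -> (~` range gamma) (shear h (x, y)).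
  by move=> yf [t _ /(shear_inj hL)[tx ty]]; rewrite -ty tx eqxx in yf.
have low (p : R * R) : p.2 < 0 -> (~` range gamma) p.
  by move=> p0 [t _ tp]; have := gamma2 t; rewrite tp; lra.
have high (p : R * R) : w < p.2 -> (~` range gamma) p.
  by move=> p0 [t _ tp]; have := gamma2 t; rewrite tp; lra.
pose pm : R * R := (0, - 1); pose pp : R * R := (0, w + 1).
have lowC (p : R * R) : p.2 < 0 ->
    connected_component (~` range gamma) pm p.
  move=> p0; apply: segment_connected_component => t /andP[t0 t1].
  by apply: low; rewrite /pm /=; have [th|th] := ltP t (1 / 2); nra.
have highC (p : R * R) : w < p.2 ->
    connected_component (~` range gamma) pp p.
  move=> p0; apply: segment_connected_component => t /andP[t0 t1].
  by apply: high; rewrite /pp /=; have [th|th] := ltP t (1 / 2); nra.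
exists gamma; split.
- move=> t t'; split.
    apply: le_trans (shear_dist_ge hL _ _).
    apply: (@le_trans _ _ (2 / 3 * `|t - t'|)); last first.
      by rewrite ler_wpM2l ?(ler_norm1_eucl (t, f t) (t', f t'))//; lra.
    rewrite ler_wpM2r// (@le_trans _ _ 2^-1)//; last by lra.
    by rewrite -mulrA lef_pV2 ?posrE; lra.
  apply: (le_trans (shear_dist_le hL _ _)).
  apply: (@le_trans _ _ (4 / 3 * ((1 + K) * `|t - t'|))).
    rewrite ler_wpM2l//.
    apply: (le_trans (eucl_dist_le_l1 _ _)).
    by rewrite mulrDl mul1r lerD2l/= fK.
  by rewrite mulrA ler_wpM2r// KE -[leRHS]mulrA; lra.
- move=> t; split=> //=.
  rewrite addrC addKr; have := hb (t, f t).
  by rewrite ler_norml; lra.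
- move=> t p Xp; rewrite -[p in eucl_dist p _]hq//.
  apply: le_trans (shear_dist_ge hL _ _).
  have := @wave_far R (s / 8) (3 * s / 100) w s f (b p) (m p) p.2 t.
  by rewrite -/(q p) => /(_ _ (Xs _ Xp) fE) H; have := H _; lra.
- exists (connected_component (~` range gamma) pp).
  exists (connected_component (~` range gamma) pm).
  split.
  + split; first by exists pp => //; apply: high => /=; lra.
    by move=> p [_] /=; rewrite in_itv/= andbT; exact: highC.
  + split; first by exists pm => //; apply: low => /=; lra.
    by move=> p [_] /=; rewrite in_itv/=; exact: lowC.
  + move=> p Yp; have Xp := YX _ Yp; have := Xs _ Xp.
    have fw : f (q p).1 = w by rewrite fq /b mem_set.
    move=> /andP[sp pw].
    apply: (@connected_component_trans _ _ (shear h ((q p).1, - 1))).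
      by apply: lowC => /=; lra.
    rewrite -[p in X in _ X]hq//.
    apply: (@path_connected_component _ _ _ (fun y => shear h ((q p).1, y))
      [set` `]-oo, w[]).
    * exact: shear_vertical_continuous.
    * exact: interval_is_interval.
    * by rewrite /= in_itv/=; lra.
    * by rewrite /= in_itv/=; lra.
    * by move=> y; rewrite /= in_itv/= => yw; apply: off; rewrite fw lt_eqF.
  + move=> p [Xp nYp]; have := Xs _ Xp.
    have f0 : f (q p).1 = 0 by rewrite fq /b memNset.
    move=> /andP[sp pw].
    apply: (@connected_component_trans _ _ (shear h ((q p).1, w + 1))).
      by apply: highC => /=; lra.
    rewrite -[p in X in _ X]hq//.
    apply: (@path_connected_component _ _ _ (fun y => shear h ((q p).1, y))
      [set` `]0, +oo[]).
    * exact: shear_vertical_continuous.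
    * exact: interval_is_interval.
    * by rewrite /= in_itv/=; lra.
    * by rewrite /= in_itv/=; lra.
    * move=> y; rewrite /= in_itv/= andbT => y0; apply: off.
      by rewrite f0 gt_eqF.
Qed.
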